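(* Suppose that $\nabla\mathbb V$ is Lipschitz, and let $\hat X\in E$. For $\Delta t,\rho>0$ and $c\ge0$ put $c_1:=\rho(\Delta t)^2(1+c(\Delta t)^2)$, $c_2:=\rho(\Delta t)^3(1+c(\Delta t)^2)$, $c_3:=c\rho(\Delta t)^3$, $T:=I-c_2\mathbb B\mathbb B^*$. For a potential $\hat{\mathbb V}$ specified below consider the iterates $(X^l)_{l\in\mathbb N_0},(V^l)_{l\in\mathbb N_0}\subseteq E$ with $X^0=X_0$, $V^0=V_0\in E$ and $$X^{l+1}=X^l+\Delta t\,V^{l+1},\qquad V^{l+1}=V^l-\Delta t\,T\bigl(\Psi(X^l)+c_1T^{-1/2}\mathbb B\mathbb B^*T^{-1/2}\bigr)V^l-\Delta t\,T\bigl(\nabla\mathbb V(X^l)+\nabla\hat{\mathbb V}(X^l)\bigr).$$ (i) Suppose there exist $\underline\psi>0$ and a closed subspace $E_0\subseteq\operatorname{ran}(\mathbb B)$ with orthogonal projection $P_{E_0}$ such that $\langle W,\Psi(X)W\rangle\ge\underline\psi\|(I-P_{E_0})W\|^2$ for all $W,X\in E$, and let $\hat{\mathbb V}(X)=\frac{c_3}{2}\|\mathbb B^*T^{-1/2}(X-\hat X)\|^2$. Then there exists a constant $0<\alpha<1$ such that for every $\gamma\in(0,1]$ and all $\overline c\ge0$ there exists $h>0$ such that if $$0<\Delta t\le h,\qquad\frac{\gamma\alpha}{(\Delta t)^3(1+c(\Delta t)^2)\|\mathbb B\mathbb B^*\|}\le\rho\le\frac{\alpha}{(\Delta t)^3(1+c(\Delta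 t)^2)\|\mathbb B\mathbb B^*\|},\qquad0\le c\le\overline c,$$ then $V^l\to0$ and $\nabla\mathbb V(X^l)+c\rho(\Delta t)^3T^{-1}\mathbb B\mathbb B^*(X^l-\hat X)\to0$ in $E$ as $l\to\infty$. (ii) Let $\mathbb B$ be surjective and $\hat{\mathbb V}(X)=\frac{c_3}{2}\|\mathbb B^*T^{-1/2}(X-\hat X)\|^2-\langle\nabla\mathbb V(\hat X),X-\hat X\rangle$. Then there exist constants $0<\alpha<1$ and $K>0$ such that for all $\gamma\in(0,1]$ and all $\overline c,\underline c$ satisfying $$\overline c\ge\underline c>\frac{K\|\mathbb B\mathbb B^*\|}{\gamma\alpha}>0$$ there exists $h>0$ such that if $$0<\Delta t\le h,\qquad\frac{\gamma\alpha}{(\Delta t)^3(1+c(\Delta t)^2)\|\mathbb B\mathbb B^*\|}\le\rho\le\frac{\alpha}{(\Delta t)^3(1+c(\Delta t)^2)\|\mathbb B\mathbb B^*\|},\qquad\underline c\le c\le\overline c,$$ then $V^l\to0$ and $X^l\to\hat X$ in $E$ as $l\to\infty$.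
   Context: Standing assumptions. $E,U$ are real Hilbert spaces with norms $\|\cdot\|$ and inner products $\langle\cdot,\cdot\rangle$; gradients are Riesz gradients. $\mathbb V\in C^1(E;\mathbb R)$ is bounded from below by $\underline{\mathcal V}\in\mathbb R$ and there is $C>0$ with $\|\nabla\mathbb V(X)\|^2\le C(1+\mathbb V(X)-\underline{\mathcal V})$ for all $X\in E$. $\Psi:E\to\mathscr L(E)$ is bounded (i.e. $\sup_X\|\Psi(X)\|<\infty$) and $\Psi(X)$ is self-adjoint and positive semidefinite for every $X\in E$. $\mathbb B\in\mathscr L(U;E)$ has closed range; $\mathbb B^*$ is its adjoint. The bounds on $\rho$ ensure $c_2\|\mathbb B\mathbb B^*\|\le\alpha<1$, so that $T$ is self-adjoint, positive definite and boundedly invertible. *)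

(* Defs.v *)
From HB Require Import structures.
From mathcomp Require Import all_boot all_order all_algebra.
From mathcomp Require Import all_classical all_reals all_analysis.
Set Implicit Arguments.
Unset Strict Implicit.
Unset Printing Implicit Defensive.
Import Order.TTheory GRing.Theory Num.Theory.
Import numFieldNormedType.Exports.
Local Open Scope classical_set_scope.
Local Open Scope ring_scope.

HB.mixin Record CompleteNormedModule_hasInner (R : realType) E
    of CompleteNormedModule R E := {
  inner : E -> E -> R;
  innerC : forall x y, inner x y = inner y x;
  innerP : forall (a : R) (x y z : E),
    inner (a *: x + y) z = a * inner x z + inner y z;
  inner_norm : forall x, inner x x = `|x| ^+ 2
}.

#[short(type="hilbertType")]
HB.structure Definition Hilbert (R : realType) :=
  {E of CompleteNormedModule_hasInner R E & CompleteNormedModule R E}.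

(* The adjoint, inverse, square root, gradient and projection below are total
   operators: when the object they name does not exist, [xget] returns its
   first argument. *)
Section operators.
Variable R : realType.
Implicit Types E U : hilbertType R.

(* The supremum over the closed unit ball is the operator norm for continuous
   linear A only ([sup] of an unbounded set is 0). *)
Definition opnorm E U (A : U -> E) : R :=
  sup [set `|A x| | x in [set x | `|x| <= 1]].

Definition adjoint E U (A : U -> E) (x : E) : U :=
  xget 0 [set u | forall w, inner (A w) x = inner w u].

Definition self_adjoint E (A : E -> E) : Prop :=
  forall x y, inner (A x) y = inner x (A y).

Definition positive_semidefinite E (A : E -> E) : Prop :=
  forall x, 0 <= inner x (A x).

Definition inv_op E (A : E -> E) (y : E) : E := xget 0 [set x | A x = y].

Definition sqrt_op E (A : E -> E) : E -> E :=
  xget (idfun : E -> E) [set S : E -> E | [/\ linear S, continuous S, self_adjoint S,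
                      positive_semidefinite S & S \o S = A]].

Definition linear_subspace E (F : set E) : Prop :=
  F 0 /\ forall (a : R) x y, F x -> F y -> F (a *: x + y).

Definition orth_proj E (F : set E) (x : E) : E :=
  xget 0 [set y | F y /\ forall z, F z -> inner (x - y) z = 0].

Definition grad E (f : E -> R) (x : E) : E :=
  xget 0 [set g | forall h, 'd f x h = inner g h].

(* By the Riesz isometry, continuity of the gradient is continuity of the
   derivative in operator norm. *)
Definition C1 E (f : E -> R) : Prop :=
  (forall x, differentiable f x) /\ continuous (grad f).

End operators.

Section scheme.
Variables (R : realType) (E U : hilbertType R).
Variables (B : U -> E) (dt rho c : R).

Definition BBadj : E -> E := B \o adjoint B.

Definition c1 : R := rho * dt ^+ 2 * (1 + c * dt ^+ 2).
Definition c2 : R := rho * dt ^+ 3 * (1 + c * dt ^+ 2).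
Definition c3 : R := c * rho * dt ^+ 3.

Definition opT (x : E) : E := x - c2 *: BBadj x.
Definition opT_inv : E -> E := inv_op opT.
Definition opT_invsqrt : E -> E := inv_op (sqrt_op opT).

Definition quad_potential (Xhat X : E) : R :=
  c3 / 2 * `|adjoint B (opT_invsqrt (X - Xhat))| ^+ 2.

Definition tilted_potential (pot : E -> R) (Xhat X : E) : R :=
  quad_potential Xhat X - inner (grad pot Xhat) (X - Xhat).

Definition iterates (Psi : E -> E -> E) (pot pothat : E -> R) (X0 V0 : E)
    (X V : nat -> E) : Prop :=
  [/\ X 0%N = X0, V 0%N = V0,
      forall l, X l.+1 = X l + dt *: V l.+1 &
      forall l, V l.+1 =
        V l - dt *: opT (Psi (X l) (V l)
                         + c1 *: opT_invsqrt (BBadj (opT_invsqrt (V l))))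
            - dt *: opT (grad pot (X l) + grad pothat (X l))].

Definition rho_window (gamma alpha : R) : Prop :=
  gamma * alpha / (dt ^+ 3 * (1 + c * dt ^+ 2) * opnorm BBadj) <= rho
    <= alpha / (dt ^+ 3 * (1 + c * dt ^+ 2) * opnorm BBadj).

End scheme.

(* Main.v *)
Require Import Defs.
From HB Require Import structures.
From mathcomp Require Import all_boot all_order all_algebra.
From mathcomp Require Import all_classical all_reals all_analysis.
From mathcomp Require Import ring lra.
Set Implicit Arguments.
Unset Strict Implicit.
Unset Printing Implicit Defensive.
Import Order.TTheory GRing.Theory Num.Theory.
Import numFieldNormedType.Exports.
Local Open Scope classical_set_scope.
Local Open Scope ring_scope.

(* With A = B B^* and alpha = 1/2 the damping and steering terms combine into
   T^-1 V' = V - dt Psi(X) V - dt G(X), where G = grad (pot + pothat) and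
   T^-1 = I + (positive semidefinite): a semi-implicit damped step. It makes
   the energy H = (pot + pothat)(X) + |V|^2 / 2 satisfy
     H' + c2 |B^* V'|^2 + (dt / 2) <V', Psi(X) V'> <= H + O(dt^2) |V'|^2,
   because grad pot is Lipschitz and c3 |A| <= c. The window for rho keeps c2
   away from 0, and |B^* W| is coercive on the closed range of B, so for small
   dt the friction beats the error term: H decreases by at least a multiple of
   |V'|^2. Hence V -> 0, and then G(X) -> 0 by the recursion. In (ii) the
   quadratic part of pothat dominates the Lipschitz constant of grad pot, so
   that G is strongly monotone with zero Xhat and G(X) -> 0 forces X -> Xhat. *)

(** * Bilinearity and Cauchy-Schwarz *)

Section inner_product.
Context {R : realType} {E : hilbertType R}.
Implicit Types (x y z : E) (a : R).

Lemma innerDl x y z : inner (x + y) z = inner x z + inner y z.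
Proof. by have := innerP 1 x y z; rewrite scale1r mul1r. Qed.

Lemma inner0l z : inner 0 z = 0.
Proof.
have /eqP := innerDl 0 0 z.
by rewrite addr0 -subr_eq subrr => /eqP.
Qed.

Lemma innerZl a x z : inner (a *: x) z = a * inner x z.
Proof. by have := innerP a x 0 z; rewrite addr0 inner0l addr0. Qed.

Lemma innerNl x z : inner (- x) z = - inner x z.
Proof. by rewrite -scaleN1r innerZl mulN1r. Qed.

Lemma innerDr x y z : inner z (x + y) = inner z x + inner z y.
Proof. by rewrite innerC innerDl !(innerC z). Qed.

Lemma inner0r z : inner z 0 = 0.
Proof. by rewrite innerC inner0l. Qed.

Lemma innerZr a x z : inner z (a *: x) = a * inner z x.
Proof. by rewrite innerC innerZl (innerC z). Qed.

Lemma innerNr x z : inner z (- x) = - inner z x.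
Proof. by rewrite innerC innerNl (innerC z). Qed.

Lemma normD_sq x y : `|x + y| ^+ 2 = `|x| ^+ 2 + 2 * inner x y + `|y| ^+ 2.
Proof. by rewrite -!inner_norm !innerDl !innerDr (innerC y x); lra. Qed.

Lemma normB_sq x y : `|x - y| ^+ 2 = `|x| ^+ 2 - 2 * inner x y + `|y| ^+ 2.
Proof. by rewrite normD_sq innerNr normrN; lra. Qed.

(** Cauchy-Schwarz, from expanding the square of the norm of |y| x - |x| y. *)
Lemma inner_le x y : inner x y <= `|x| * `|y|.
Proof.
have [->|x0] := eqVneq x 0; first by rewrite inner0l normr0 mul0r.
have [->|y0] := eqVneq y 0; first by rewrite inner0r normr0 mulr0.
have xy0 : 0 < `|x| * `|y| by rewrite mulr_gt0 ?normr_gt0.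
have := sqr_ge0 `| `|y| *: x - `|x| *: y|.
rewrite normB_sq !normrZ !normr_id innerZl innerZr => h.
have : 0 <= (`|x| * `|y|) * (`|x| * `|y| - inner x y) by nra.
by rewrite pmulr_rge0// subr_ge0.
Qed.

Lemma normr_inner_le x y : `|inner x y| <= `|x| * `|y|.
Proof.
by rewrite ler_norml inner_le andbT lerNl -innerNl -(normrN x) inner_le.
Qed.

Lemma inner_eq x y : (forall z, inner x z = inner y z) -> x = y.
Proof.
move=> h; apply/subr0_eq/normr0_eq0/eqP; rewrite -sqrf_eq0 -inner_norm.
by rewrite innerDl innerNl h subrr.
Qed.

End inner_product.

(** * Linear maps and convergence of geometrically controlled sequences *)

Section linear_maps.
Context {R : realType}.
Implicit Types V W : normedModType R.

Lemma linear_pack V W (f : V -> W) :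
  linear f -> exists g : {linear V -> W}, f = g.
Proof.
move=> lf.
pose g : {linear V -> W} := HB.pack f (GRing.isLinear.Build _ _ _ _ _ lf).
by exists g.
Qed.

Lemma bounded_continuous V W (f : V -> W) (k : R) :
  linear f -> (forall x, `|f x| <= k * `|x|) -> continuous f.
Proof.
move=> /linear_pack[g ->] gk; apply/linear_bounded_continuous/bounded_funP => r.
exists (`|k| * r) => x xr; apply: (le_trans (gk x)).
by apply: (le_trans (ler_wpM2r _ (ler_norm k))) => //; apply: ler_wpM2l.
Qed.

(** The increments form a normally convergent series that telescopes back to u. Completeness enters
    through this criterion for projections, square roots and inverses alike. *)
Lemma geometric_cvg (V : completeNormedModType R) (u : nat -> V) (c : R) :
  (forall n, `|u n.+1 - u n| <= c * 2^-1 ^+ n) -> exists l : V, u @ \oo --> l.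
Proof.
move=> uc.
have h : cvgn (series (fun n => u n.+1 - u n)).
  apply: normed_cvg; apply: (@series_le_cvg _ _ (geometric c 2^-1)) => //.
  - by move=> n /=.
  - by move=> n /=; exact: le_trans (normr_ge0 _) (uc n).
  - apply: is_cvg_geometric_series.
    by rewrite ger0_norm ?invr_ge0// invf_lt1 // ltr1n.
move/cvg_ex: h => [l hl]; exists (u 0%N + l).
apply: cvg_trans (cvgD (cvg_cst (u 0%N)) hl); apply: near_eq_cvg.
apply: nearW => n; rewrite /series/= -[LHS]/(u 0%N + _) telescope_sumr//.
by rewrite addrC subrK.
Qed.

End linear_maps.

(** * Orthogonal projection and Riesz representation *)

Section projection.
Context {R : realType} {E : hilbertType R}.

Lemma inner_continuous (y : E) : continuous (inner ^~ y : E -> R).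
Proof.
apply: (@bounded_continuous _ _ _ _ `|y|); last first.
  by move=> x; rewrite mulrC normr_inner_le.
by move=> a x z; rewrite innerP.
Qed.

(** Centred at x: if y and z nearly minimise the distance from x to a subspace, their midpoint
    cannot do much better, so y and z are close. *)
Lemma parallelogram (x y z : E) :
  `|y - z| ^+ 2 = 2 * `|x - y| ^+ 2 + 2 * `|x - z| ^+ 2
    - 4 * `|x - 2^-1 *: (y + z)| ^+ 2.
Proof.
rewrite !normB_sq normrZ ger0_norm ?invr_ge0// exprMn normD_sq innerZr innerDr.
by field.
Qed.

Lemma projection_exists (F : set E) (x : E) :
  linear_subspace F -> closed F ->
  exists y, F y /\ forall z, F z -> inner (x - y) z = 0.
Proof.
move=> [F0 FP] clF.
have FZ a y : F y -> F (a *: y).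
  by move=> Fy; rewrite -[_ *: _]addr0; apply: FP.
have FD y z : F y -> F z -> F (y + z).
  by move=> Fy Fz; rewrite -[y]scale1r; apply: FP.
pose S := [set `|x - y| ^+ 2 | y in F].
have Slb : has_lbound S by exists 0 => _ [y _ <-]; apply: sqr_ge0.
have Sinf : has_inf S by split => //; exists (`|x - 0| ^+ 2), 0.
pose d := inf S.
have dle y : F y -> d <= `|x - y| ^+ 2.
  by move=> Fy; apply: ge_inf => //; exists y.
have q0 n : 0 < 4^-1 ^+ n :> R by rewrite exprn_gt0.
have hy n : exists y, F y /\ `|x - y| ^+ 2 < d + 4^-1 ^+ n.
  have [_ [y Fy <-] hy] := inf_adherent (q0 n) Sinf.
  by exists y.
have [u Fu] := choice hy.
(* The squared distances exceed d by less than 4^-n, so the parallelogram identity bounds the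
   squared increment by 4 * 4^-n, the square of 2 * 2^-n. *)
have [n|y uy] := @geometric_cvg _ _ u 2.
  rewrite -(@ler_pXn2r _ 2)// ?nnegrE// ?mulr_ge0 ?exprn_ge0 ?invr_ge0//.
  rewrite exprMn -exprM mulnC exprM.
  have -> : (2^-1 ^+ 2 : R) = 4^-1 by field.
  rewrite (parallelogram x).
  have [Fn hn] := Fu n; have [Fn1 hn1] := Fu n.+1.
  have := dle _ (FZ 2^-1 _ (FD _ _ Fn1 Fn)).
  have : 4^-1 ^+ n.+1 <= 4^-1 ^+ n :> R.
    by rewrite exprS; have := q0 n; lra.
  by move: hn hn1; nra.
have Fy : F y.
  by apply: (closed_cvg _ clF _ _ uy); apply: nearW => n; exact: (Fu n).1.
exists y; split => // z Fz.
have hd : `|x - y| ^+ 2 <= d.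
  have h1 : (fun n => `|x - u n| ^+ 2) @ \oo --> `|x - y| ^+ 2.
    rewrite expr2; under eq_fun do rewrite expr2.
    have h : (fun n => `|x - u n|) @ \oo --> `|x - y|.
      by apply: cvg_norm; apply: cvgB => //; apply: cvg_cst.
    exact: cvgM.
  have h2 : (fun n => d + 4^-1 ^+ n) @ \oo --> d.
    rewrite -[X in _ --> X]addr0; apply: cvgD; first exact: cvg_cst.
    by apply: cvg_expr; rewrite ger0_norm ?invr_ge0// invf_lt1 // ltr1n.
  apply: (ler_cvg_to h1 h2); apply: nearW => n; exact/ltW/(Fu n).2.
have [->|z0] := eqVneq z 0; first by rewrite inner0r.
have nz : 0 < `|z| ^+ 2 by rewrite exprn_gt0// normr_gt0.
set i := inner (x - y) z.
(* Minimality of y is tested against the best competitor on the line through y in direction z; it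
   would improve the squared distance by i^2 / |z|^2. *)
have := dle _ (FD _ _ Fy (FZ (i / `|z| ^+ 2) _ Fz)).
rewrite opprD addrA normB_sq innerZr -/i normrZ exprMn real_normK ?num_real//.
have -> : `|x - y| ^+ 2 - 2 * (i / `|z| ^+ 2 * i)
    + (i / `|z| ^+ 2) ^+ 2 * `|z| ^+ 2 = `|x - y| ^+ 2 - i ^+ 2 / `|z| ^+ 2.
  by field; rewrite normr_eq0.
move=> h.
have : i ^+ 2 / `|z| ^+ 2 <= 0 by lra.
rewrite ler_pdivrMr// mul0r => i0.
by apply/eqP; rewrite -sqrf_eq0; apply/eqP/le_anti; rewrite i0 sqr_ge0.
Qed.

Lemma orth_projP (F : set E) : linear_subspace F -> closed F ->
  forall x, F (orth_proj F x) /\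
    forall z, F z -> inner (x - orth_proj F x) z = 0.
Proof. by move=> lF cF x; exact: (xgetPex 0 (projection_exists x lF cF)). Qed.

(** For f <> 0, the component w of some v orthogonal to the kernel spans the complement of the
    kernel, and a multiple of w represents f. *)
Lemma riesz (f : {linear E -> R}) : continuous f ->
  exists g, forall h, f h = inner g h.
Proof.
move=> cf.
have [[v fv]|/forallNP f0] := pselect (exists v, f v != 0); last first.
  exists 0 => h; rewrite inner0l; apply/eqP.
  by have /negP := f0 h; rewrite negbK.
have lK : linear_subspace (f @^-1` [set 0]).
  split => [|a x y /= fx fy]; first by rewrite /= linear0.
  by rewrite linearP fx fy scaler0 addr0.
have cK : closed (f @^-1` [set 0]).
  by apply: ((continuous_closedP f).1 cf); exact: closed_eq.
have [p [/= fp ph]] := projection_exists v lK cK.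
pose w := v - p.
have fw : f w = f v by rewrite linearB fp subr0.
have w0 : `|w| ^+ 2 != 0.
  rewrite sqrf_eq0 normr_eq0; apply: contra fv => /eqP w0.
  by rewrite -fw w0 linear0.
exists ((f w / `|w| ^+ 2) *: w) => h.
have fz : f (h - (f h / f w) *: w) = 0.
  by rewrite linearB linearZ /= -[_ *: _]/(_ * _) fw divfK ?subrr.
have /eqP := ph _ fz; rewrite -/w innerDr innerNr innerZr inner_norm subr_eq0.
move=> /eqP hh; rewrite innerZl hh.
have fw0 : f w != 0 by rewrite fw.
by move: (`|w| ^+ 2) w0 => n n0; field; rewrite n0 fw0.

Qed.

End projection.

(** * Operator norm, adjoint, and coercivity of the adjoint on a closed range *)

Section bounded_operators.
Context {R : realType}.
Implicit Types E U : hilbertType R.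

Lemma linear_add (V W : lmodType R) (f : V -> W) :
  linear f -> {morph f : x y / x + y}.
Proof. by move=> lf x y; have := lf 1 x y; rewrite !scale1r. Qed.

Lemma linear_zero (V W : lmodType R) (f : V -> W) : linear f -> f 0 = 0.
Proof.
move=> lf; have /eqP := linear_add lf 0 0.
by rewrite addr0 -subr_eq subrr => /eqP.
Qed.

Lemma linear_scale (V W : lmodType R) (f : V -> W) (a : R) x :
  linear f -> f (a *: x) = a *: f x.
Proof. by move=> lf; rewrite -[a *: x]addr0 lf (linear_zero lf) addr0. Qed.

Lemma linear_sub (V W : lmodType R) (f : V -> W) :
  linear f -> {morph f : x y / x - y}.
Proof.
by move=> lf x y; rewrite -scaleN1r linear_add// linear_scale// scaleN1r.
Qed.

Lemma opnorm_ub E U (f : U -> E) : linear f -> continuous f ->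
  has_ubound [set `|f x| | x in [set x | `|x| <= 1]].
Proof.
move=> /linear_pack[g ->] /linear_lipschitz[k k0 hk].
exists k => _ [x x1 <-]; apply: le_trans (hk x) _.
by rewrite ler_piMr// ltW.
Qed.

Lemma opnorm_ge0 E U (f : U -> E) : linear f -> continuous f -> 0 <= opnorm f.
Proof.
move=> lf cf; apply: (ub_le_sup (opnorm_ub lf cf)).
by exists 0; rewrite /= ?normr0// linear_zero// normr0.
Qed.

Lemma le_opnorm E U (f : U -> E) x : linear f -> continuous f ->
  `|f x| <= opnorm f * `|x|.
Proof.
move=> lf cf; have [->|x0] := eqVneq x 0.
  by rewrite linear_zero// !normr0 mulr0.
have nx : 0 < `|x| by rewrite normr_gt0.
rewrite -ler_pdivrMr//; apply: (ub_le_sup (opnorm_ub lf cf)).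
exists (`|x|^-1 *: x) => /=; last first.
  by rewrite linear_scale// normrZ normfV normr_id mulrC.
by rewrite normrZ normfV normr_id mulVf// gt_eqF.
Qed.

Section adjoint.
Context {E U : hilbertType R} (B : {linear U -> E}).
Hypothesis cB : continuous B.

(** Riesz applied to w -> <B w, x> shows that the default value in [adjoint] is not taken. *)
Lemma adjointP w x : inner (B w) x = inner w (adjoint B x).
Proof.
have lf : linear (fun w => inner (B w) x).
  by move=> a u v; rewrite linearP innerP.
have [g gE] := linear_pack lf.
have cg : continuous g.
  rewrite -gE => u; apply: (@continuous_comp _ _ _ B (inner ^~ x)).
    exact: cB.
  exact: inner_continuous.
have [u hu] := riesz cg.
have : exists u, forall w, inner (B w) x = inner w u.
  by exists u => v; rewrite innerC (innerC v) -hu -gE innerC.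
by move=> /(xgetPex 0); apply.
Qed.

Lemma adjoint_linear : linear (adjoint B).
Proof.
move=> a x y; apply: inner_eq => z.
by rewrite innerC -adjointP innerP innerDr innerZr !adjointP !(innerC z).
Qed.

(** From |B^* x|^2 = <B B^* x, x> <= k |B^* x| |x|. *)
Lemma adjoint_bound k : 0 <= k -> (forall x, `|B x| <= k * `|x|) ->
  forall x, `|adjoint B x| <= k * `|x|.
Proof.
move=> k0 hk x; have [->|u0] := eqVneq (adjoint B x) 0.
  by rewrite normr0 mulr_ge0.
have nu : 0 < `|adjoint B x| by rewrite normr_gt0.
rewrite -(ler_pM2r nu) -expr2 -inner_norm -adjointP.
by apply: (le_trans (inner_le _ _)); rewrite mulrAC ler_wpM2r.
Qed.

Lemma adjoint_continuous : continuous (adjoint B).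
Proof.
have [k k0 hk] := linear_lipschitz cB.
exact: bounded_continuous adjoint_linear (adjoint_bound (ltW k0) hk).
Qed.

Lemma BBadj_linear : linear (BBadj B).
Proof. by move=> a x y; rewrite /BBadj /= adjoint_linear linearP. Qed.

Lemma BBadj_continuous : continuous (BBadj B).
Proof.
by move=> x; apply: continuous_comp; [exact: adjoint_continuous | exact: cB].
Qed.

Lemma BBadj_inner x y : inner (BBadj B x) y = inner (adjoint B x) (adjoint B y).
Proof. exact: adjointP. Qed.

Lemma BBadj_self_adjoint : self_adjoint (BBadj B).
Proof. by move=> x y; rewrite BBadj_inner innerC -BBadj_inner innerC. Qed.

Hypothesis clB : closed (range B).

(* The functionals <W, _> with W in the range and |B^* W| <= 1 are pointwise
   bounded: project onto the range and write the projection as [B u]. *)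
Lemma adjoint_coercive :
  exists2 k : R, 0 < k & forall W, range B W -> `|W| <= k * `|adjoint B W|.
Proof.
have lR : linear_subspace (range B).
  split; first by exists 0; rewrite ?linear0.
  by move=> a _ _ [x _ <-] [y _ <-]; exists (a *: x + y); rewrite ?linearP.
pose F : set (E -> R^o) :=
  [set inner W | W in [set W | range B W /\ `|adjoint B W| <= 1]].
have : uniform_bounded F.
  apply: Banach_Steinhauss => [_ [W _ <-]|y].
    split => [r|a x z]; last by rewrite innerDr innerZr.
    exists (`|W| * r) => x xr; apply: (le_trans (normr_inner_le _ _)).
    by apply: ler_wpM2l.
  have [[u _ uy] orth] := orth_projP lR clB y.
  exists `|u| => _ [W [RW W1] <-].
  have := orth _ RW; rewrite -uy innerDl innerNl => /eqP.
  rewrite subr_eq0 => /eqP yW; rewrite innerC yW adjointP.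
  by apply: (le_trans (normr_inner_le _ _)); rewrite ler_piMr.
move=> /(_ 1)[M hM]; exists (`|M| + 1); first by rewrite ltr_pwDr.
(* The functional [inner W] takes the value |W| at the unit vector W / |W|, so the uniform bound on
   the unit ball bounds |W|. *)
have normle W : range B W -> `|adjoint B W| <= 1 -> `|W| <= `|M| + 1.
  move=> RW W1; have [->|W0] := eqVneq W 0; first by rewrite normr0 addr_ge0.
  have nW : 0 < `|W| by rewrite normr_gt0.
  have := hM (inner W) _ (`|W|^-1 *: W).
  rewrite normrZ normfV normr_id mulVf ?gt_eqF// lexx innerZr inner_norm.
  rewrite expr2 mulKf ?gt_eqF// normr_id => h.
  apply: (@le_trans _ _ M); first by apply: h => //; exists W.
  by apply: (le_trans (ler_norm _)); rewrite lerDl.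
move=> W RW; have [aW0|aW0] := eqVneq (adjoint B W) 0.
  have [u _ uW] := RW; suff -> : W = 0 by rewrite normr0 mulr_ge0// addr_ge0.
  apply/eqP; rewrite -normr_eq0 -sqrf_eq0 -inner_norm -{1}uW adjointP aW0.
  by rewrite inner0r.
have nW : 0 < `|adjoint B W| by rewrite normr_gt0.
have := normle (`|adjoint B W|^-1 *: W).
rewrite (linear_scale _ _ adjoint_linear) !normrZ normfV normr_id.
rewrite mulVf ?gt_eqF// lexx mulrC ler_pdivrMr// => h; apply: h => //.
have [_ /(_ (`|adjoint B W|^-1) W 0 RW)] := lR.
by rewrite addr0; apply; exists 0; rewrite ?linear0.
Qed.

End adjoint.

End bounded_operators.

(** * Square root and inverse of I - A for self-adjoint A of norm at most 1/2 *)

Section square_root.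
Context {R : realType} {E : hilbertType R} (A : E -> E).
Hypothesis linA : linear A.
Hypothesis sA : self_adjoint A.
Hypothesis bA : forall x, `|A x| <= 2^-1 * `|x|.

(* Fixed-point iteration for Y = (A + Y^2) / 2, i.e. (I - Y)^2 = I - A. *)
Fixpoint sqrt_iter n (x : E) : E :=
  if n is m.+1 then 2^-1 *: (A x + sqrt_iter m (sqrt_iter m x)) else 0.

Lemma sqrt_iter_linear n : linear (sqrt_iter n).
Proof.
elim: n => [|n ih] a x y /=; first by rewrite scaler0 addr0.
rewrite linA !ih scalerA mulrC -scalerA -scalerDr !scalerDr.
by rewrite -!addrA; congr (_ + _); rewrite addrCA.
Qed.

Lemma sqrt_iter_self_adjoint n : self_adjoint (sqrt_iter n).
Proof.
elim: n => [|n ih] x y /=; first by rewrite inner0l inner0r.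
by rewrite innerZl innerZr innerDl innerDr sA !ih.
Qed.

(** The bound 1/2 is preserved by the iteration because (1/2 + 1/4) / 2 <= 1/2. *)
Lemma sqrt_iter_bound n x : `|sqrt_iter n x| <= 2^-1 * `|x|.
Proof.
elim: n x => [|n ih] x /=; first by rewrite normr0 mulr_ge0// invr_ge0.
rewrite normrZ ger0_norm ?invr_ge0// ler_pM2l ?invr_gt0//.
have := ler_normD (A x) (sqrt_iter n (sqrt_iter n x)).
have := bA x; have := ih x; have := ih (sqrt_iter n x).
by have := normr_ge0 x; lra.
Qed.

Lemma sqrt_iter_step n x :
  `|sqrt_iter n.+1 x - sqrt_iter n x| <= `|x| * 2^-1 ^+ n.
Proof.
elim: n x => [|n ih] x.
  rewrite expr0 mulr1 subr0; apply: (le_trans (sqrt_iter_bound _ _)).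
  by rewrite ler_piMl// invf_le1// ler1n.
(* Difference of squares as Y'(Y' - Y) + (Y' - Y) Y. Both outer factors have norm at most 1/2, so
   the prefactor 1/2 remains as contraction rate. *)
have -> : sqrt_iter n.+2 x - sqrt_iter n.+1 x = 2^-1 *:
    (sqrt_iter n.+1 (sqrt_iter n.+1 x - sqrt_iter n x)
     + (sqrt_iter n.+1 (sqrt_iter n x) - sqrt_iter n (sqrt_iter n x))).
  rewrite (linear_sub (@sqrt_iter_linear n.+1)).
  rewrite [LHS]/= -scalerBr; congr (_ *: _).
  rewrite [in RHS]addrA subrK opprD addrACA subrr add0r //.
rewrite normrZ ger0_norm ?invr_ge0// exprS mulrCA ler_pM2l ?invr_gt0//.
apply: (le_trans (ler_normD _ _)).
have := sqrt_iter_bound n.+1 (sqrt_iter n.+1 x - sqrt_iter n x).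
have := ih x; have := ih (sqrt_iter n x); have := sqrt_iter_bound n x.
have : 0 <= 2^-1 ^+ n :> R by rewrite exprn_ge0// invr_ge0.
by nra.
Qed.

Lemma sqrt_1subr_exists : exists S : E -> E,
  [/\ linear S, continuous S, self_adjoint S, positive_semidefinite S
    & S \o S = (fun x => x - A x)].
Proof.
have [Y hY] := choice (fun x => geometric_cvg (sqrt_iter_step ^~ x)).
have linY : linear Y.
  move=> a x y; apply: (cvg_unique _ (hY _)) => //.
  rewrite (_ : (fun n => _) = (fun n => a *: sqrt_iter n x + sqrt_iter n y)).
    by apply: cvgD; [apply: cvgZl_tmp|].
  by apply/funext => n; rewrite sqrt_iter_linear.
have bY x : `|Y x| <= 2^-1 * `|x|.
  apply: (ler_cvg_to (cvg_norm (hY x)) (cvg_cst _)).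
  by apply: nearW => n; exact: sqrt_iter_bound.
have innerY x y : inner (sqrt_iter n x) y @[n --> \oo] --> inner (Y x) y.
  exact: (cvg_comp (fun n => sqrt_iter n x) (inner ^~ y) (hY x)
    (@inner_continuous _ _ y (Y x))).
have sY : self_adjoint Y.
  move=> x y; apply: (cvg_unique _ (innerY x y)) => //.
  rewrite (_ : (fun n => _) = (fun n => inner (sqrt_iter n y) x)).
    by rewrite innerC; exact: innerY.
  by apply/funext => n; rewrite sqrt_iter_self_adjoint innerC.
have YY x : Y x + Y x = A x + Y (Y x).
  (* Convergence is only pointwise; the uniform bound on the iterates handles the moving
     argument. *)
  have YnY : sqrt_iter n (sqrt_iter n x) @[n --> \oo] --> Y (Y x).
    have -> : (fun n => sqrt_iter n (sqrt_iter n x)) =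
        (fun n => sqrt_iter n (sqrt_iter n x - Y x) + sqrt_iter n (Y x)).
      apply/funext => n.
      by rewrite (linear_sub (@sqrt_iter_linear n)) subrK.
    rewrite -[X in _ --> X]add0r; apply: cvgD => //.
    apply/norm_cvg0P; apply: (@squeeze_cvgr _ _ _ _ (cst 0)
      (fun n => 2^-1 * `|sqrt_iter n x - Y x|)); last 2 first.
    - exact: cvg_cst.
    - rewrite -(mulr0 2^-1) -(normr0 E); apply: cvgMl_tmp; apply: cvg_norm.
      by rewrite -(subrr (Y x)); apply: cvgB => //; exact: cvg_cst.
    - by apply: nearW => n; rewrite normr_ge0 sqrt_iter_bound.
  have YS : sqrt_iter n.+1 x @[n --> \oo] --> Y x.
    by rewrite (cvg_shiftS (fun n => sqrt_iter n x)).
  have h : sqrt_iter n.+1 x + sqrt_iter n.+1 x @[n --> \oo] --> A x + Y (Y x).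
    apply: cvg_trans (cvgD (cvg_cst (A x)) YnY); apply: near_eq_cvg.
    apply: nearW => n; rewrite -[LHS]/(A x + sqrt_iter n (sqrt_iter n x)) /=.
    by rewrite -scalerDl (_ : 2^-1 + 2^-1 = 1 :> R) ?scale1r//; field.
  exact: (cvg_unique _ (cvgD YS YS) h).
(* The limit satisfies 2 Y = A + Y^2, that is (I - Y)^2 = I - A, and |Y x| <= |x| / 2 makes I - Y
   positive. *)
exists (fun x => x - Y x); split.
- move=> a x y; rewrite linY scalerBr opprD addrACA //.
- by move=> x; apply: cvgB; [apply: cvg_id|apply: (bounded_continuous linY bY)].
- by move=> x y; rewrite innerDl innerDr innerNl innerNr sY.
- move=> x; rewrite innerDr innerNr inner_norm subr_ge0.
  apply: (le_trans (inner_le _ _)); rewrite mulrC expr2 ler_wpM2r//.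
  by apply: (le_trans (bY x)); rewrite ler_piMl// invf_le1// ler1n.
- apply/funext => x /=; rewrite (linear_sub linY) opprB.
  have -> : A x = Y x + Y x - Y (Y x) by rewrite YY addrK.
  by rewrite -addrA [in RHS]opprB opprD; congr (_ + _); rewrite addrCA.
Qed.

(** Fixed-point iteration for x = y + A x, a contraction with rate 1/2. *)
Lemma sub1_surj y : exists x, x - A x = y.
Proof.
pose u n := iter n (fun x => y + A x) 0.
have [n|x ux] := @geometric_cvg _ _ u `|y|.
  elim: n => [|n ih].
    by rewrite /u/= subr0 linear_zero// addr0 expr0 mulr1.
  have -> : u n.+2 - u n.+1 = A (u n.+1 - u n).
    by rewrite (linear_sub linA) /u/= opprD addrACA subrr add0r.
  by apply: (le_trans (bA _)); rewrite exprS mulrCA ler_pM2l ?invr_gt0.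
exists x; apply/eqP; rewrite subr_eq; apply/eqP.
have uS : u n.+1 @[n --> \oo] --> x by rewrite (cvg_shiftS u).
apply: (cvg_unique _ uS) => //.
rewrite (_ : (fun n => _) = (fun n => y + A (u n)))//.
apply: cvgD; first exact: cvg_cst.
exact: (cvg_comp u A ux (@bounded_continuous _ _ _ A _ linA bA x)).
Qed.

End square_root.

(** * Gradients and the descent inequality *)

Section gradient.
Context {R : realType} {E : hilbertType R}.
Implicit Types (f : E -> R) (x h g : E).

Lemma gradP f x h : differentiable f x -> 'd f x h = inner (grad f x) h.
Proof.
move=> /diff_continuous/riesz[g hg].
by have : exists g, forall h, 'd f x h = inner g h by [exists g];
  move=> /(xgetPex 0); apply.
Qed.

(** A quadratic remainder identifies the derivative; this yields the gradient of the steering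
    potential from its exact expansion. *)
Lemma is_grad f x g (k : R) :
  (forall h, `|f (x + h) - f x - inner g h| <= k * `|h| ^+ 2) -> grad f x = g.
Proof.
move=> hk.
have lg : linear (inner g : E -> R^o) by move=> a u v; rewrite innerDr innerZr.
have [dg dgE] := linear_pack lg.
have cdg : continuous dg.
  apply: (@bounded_continuous _ _ _ _ `|g|); first by rewrite -dgE.
  by move=> u; rewrite -dgE; exact: normr_inner_le.
have df : 'd (f : E -> R^o) x = dg :> (E -> R^o).
  apply: diff_unique => //; apply/eqaddoP => e e0.
  (* The radius e / (|k| + 1) makes k |h|^2 at most e |h|; adding 1 keeps the denominator
     positive. *)
  have k0 : 0 < `|k| + 1 by rewrite ltr_pwDr.
  near=> h; rewrite -dgE /= -[X in `|X|]/(f (h + x) - (f x + inner g h)).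
  rewrite opprD addrA (addrC h); apply: (le_trans (hk h)).
  rewrite expr2 mulrA ler_wpM2r//.
  apply: (@le_trans _ _ ((`|k| + 1) * `|h|)).
    by rewrite ler_wpM2r// (le_trans (ler_norm k))// lerDl.
  rewrite -ler_pdivlMl// mulrC.
  near: h; apply/nbhs_norm0P; exists (e / (`|k| + 1)); rewrite /= ?divr_gt0//.
  by move=> h /= /ltW.
rewrite /grad; apply: inner_eq => z.
have : exists g, forall h, 'd (f : E -> R^o) x h = inner g h.
  by exists g => h; rewrite df -dgE.
by move=> /(xgetPex 0) /(_ z) <-; rewrite df -dgE.
Unshelve. all: by end_near. Qed.

(** Mean value theorem along the segment from x to x + d, then the Lipschitz bound at the
    intermediate point. The constant is L rather than the sharp L / 2. *)
Lemma descent f (L : R) : (forall x, differentiable f x) -> 0 <= L ->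
  (forall x y, `|grad f x - grad f y| <= L * `|x - y|) ->
  forall x d, f (x + d) <= f x + inner (grad f x) d + L * `|d| ^+ 2.
Proof.
move=> df L0 lip x d.
pose phi (t : R) : R := f (x + t *: d).
have dphi (t : R) : is_derive t (1 : R) phi (inner (grad f (x + t *: d)) d).
  rewrite -gradP//.
  have h1 : is_diff t (fun t : R => x + t *: d) (fun t => 0 + t *: d).
    exact: (@is_diffD _ _ _ (cst x) _ (cst 0) _ _ _ _).
  have h2 : is_diff t phi ('d f (x + t *: d) \o (fun t => 0 + t *: d)).
    by apply: is_diff_comp; exact: differentiableP.
  have dp : differentiable phi t by [].
  apply: DeriveDef; first exact/derivable1_diffP.
  by rewrite deriveE// diff_val /= scale1r add0r.
have cphi : {within `[0, 1], continuous phi}.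
  apply: continuous_subspaceT => t.
  apply: differentiable_continuous; apply/derivable1_diffP.
  exact: ex_derive.
have [t t01] := MVT_segment ler01 (fun t _ => dphi t) cphi.
rewrite /phi scale1r scale0r addr0 subr0 mulr1 => fE.
rewrite -addrA -lerBlDl fE.
have := lip (x + t *: d) x; rewrite addrAC subrr add0r normrZ => hl.
rewrite -lerBlDl -innerNl -innerDl.
apply: (le_trans (inner_le _ _)); rewrite expr2 mulrA ler_wpM2r//.
apply: (le_trans hl); rewrite ler_wpM2l// ler_piMl//.
by move: t01; rewrite in_itv /= => /andP[t0 t1]; rewrite ger0_norm.
Qed.

End gradient.

(** * Energy decay of the semi-implicit damped step *)

Section energy.
Context {R : realType} {E : hilbertType R}.

(** The gap between the two sides is <A A z, z - A z> = |A z|^2 - <A A z, A z>, nonnegative since A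
    has norm at most 1/2. It expresses the friction through the new velocity z - A z. *)
Lemma implicit_friction (A : E -> E) (z : E) :
  linear A -> self_adjoint A -> positive_semidefinite A ->
  (forall x, `|A x| <= 2^-1 * `|x|) ->
  inner (A (z - A z)) (z - A z) <= inner (A z) (z - A z).
Proof.
move=> lA sA pA bA; rewrite (linear_sub lA) innerDl innerNl gerBl.
rewrite innerDr innerNr sA inner_norm subr_ge0.
apply: (le_trans (inner_le _ _)); rewrite expr2 ler_wpM2r//.
by apply: (le_trans (bA _)); rewrite ler_piMl// invf_le1// ler1n.
Qed.

(** The step is tested with w. Polarisation turns <v, w> into kinetic energies minus |v - w|^2 / 2.
    It also bounds - dt <Psi v, w> by - (dt/2) <Psi w, w> plus (dt/2) <Psi (v - w), v - w>, which |v
    - w|^2 / 2 absorbs because 2 dt P <= 1. *)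
Lemma energy_descent (F : E -> R) (G Psi A : E -> E) (L P dt : R)
    (x v w z : E) :
  linear A -> self_adjoint A -> positive_semidefinite A ->
  (forall x, `|A x| <= 2^-1 * `|x|) ->
  linear Psi -> self_adjoint Psi -> positive_semidefinite Psi ->
  (forall x, `|Psi x| <= P * `|x|) ->
  0 < dt -> 2 * dt * P <= 1 ->
  F (x + dt *: w) <= F x + inner (G x) (dt *: w) + L * `|dt *: w| ^+ 2 ->
  z = v - dt *: Psi v - dt *: G x -> w = z - A z ->
  F (x + dt *: w) + 2^-1 * `|w| ^+ 2 + inner (A w) w
    + dt / 2 * inner (Psi w) w <=
  F x + 2^-1 * `|v| ^+ 2 + L * dt ^+ 2 * `|w| ^+ 2.
Proof.
move=> lA sA pA bA lP sP pP bP dt0 dtP hF zE wE.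
have fr := implicit_friction z lA sA pA bA; rewrite -wE in fr.
have zw : inner z w = `|w| ^+ 2 + inner (A z) w.
  by rewrite -inner_norm {2}wE innerDl innerNl subrK.
have gw : inner (G x) (dt *: w) = inner v w - dt * inner (Psi v) w - inner z w.
  by rewrite zE !innerDl !innerNl !innerZl innerZr; ring.
have dvw := normB_sq v w.
have Pd : 0 <= inner (Psi (v + w)) (v + w) by rewrite innerC; exact: pP.
have Pd2 : inner (Psi (v - w)) (v - w) <= P * `|v - w| ^+ 2.
  apply: (le_trans (inner_le _ _)); rewrite expr2 mulrA ler_wpM2r//.
have Pvw : inner (Psi (v - w)) (v - w) =
    inner (Psi v) v - 2 * inner (Psi v) w + inner (Psi w) w.
  rewrite (linear_sub lP) !innerDl !innerDr !innerNl !innerNr.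
  by rewrite (sP w v) (innerC w (Psi v)); ring.
have Pv : 0 <= inner (Psi v) v by rewrite innerC; exact: pP.
have nd : `|dt *: w| ^+ 2 = dt ^+ 2 * `|w| ^+ 2.
  by rewrite normrZ exprMn real_normK// num_real.
rewrite nd gw zw in hF.
have s0 := sqr_ge0 `|v - w|.
have h1 : dt * inner (Psi (v - w)) (v - w) <= 2^-1 * `|v - w| ^+ 2.
  apply: (@le_trans _ _ (dt * (P * `|v - w| ^+ 2))); first by rewrite ler_pM2l.
  by rewrite mulrA ler_wpM2r//; lra.
have h2 : 0 <= dt * inner (Psi v) v by rewrite mulr_ge0// ltW.
rewrite Pvw in h1; move: hF h1 h2 dvw s0 fr; rewrite mulrA.
set p1 := inner (Psi v) v; set p2 := inner (Psi v) w; set p3 := inner (Psi w) w.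
rewrite !mulrDr !mulrN.
have -> : dt / 2 * p3 = 2^-1 * (dt * p3) by field.
have -> : dt * (2 * p2) = 2 * (dt * p2) by ring.
lra.
Qed.

Lemma energy_convergence (F : E -> R) (G : E -> E) (Psi : E -> E -> E)
    (A : E -> E) (L P dt kappa m : R) (X V Z : nat -> E) :
  linear A -> self_adjoint A -> positive_semidefinite A ->
  (forall x, `|A x| <= 2^-1 * `|x|) ->
  (forall x, linear (Psi x)) -> (forall x, self_adjoint (Psi x)) ->
  (forall x, positive_semidefinite (Psi x)) ->
  (forall x y, `|Psi x y| <= P * `|y|) ->
  0 < dt -> 2 * dt * P <= 1 -> 0 < kappa -> 2 * L * dt <= kappa ->
  (forall x d, F (x + d) <= F x + inner (G x) d + L * `|d| ^+ 2) ->
  (forall x, m <= F x) ->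
  (forall x w, dt * kappa * `|w| ^+ 2 <=
    inner (A w) w + dt / 2 * inner (Psi x w) w) ->
  (forall l, X l.+1 = X l + dt *: V l.+1) ->
  (forall l, Z l = V l - dt *: Psi (X l) (V l) - dt *: G (X l)) ->
  (forall l, V l.+1 = Z l - A (Z l)) ->
  V @ \oo --> (0 : E) /\ G (X l) @[l --> \oo] --> (0 : E).
Proof.
move=> lA sA pA bA lP sP pP bP dt0 dtP k0 Lk hF hm coer XE ZE VE.
pose H l := F (X l) + 2^-1 * `|V l| ^+ 2.
have step l : H l.+1 + dt * kappa / 2 * `|V l.+1| ^+ 2 <= H l.
  have := energy_descent lA sA pA bA (lP (X l)) (sP _) (pP _) (bP _) dt0 dtP
    (hF (X l) (dt *: V l.+1)) (ZE l) (VE l).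
  have := coer (X l) (V l.+1); rewrite -XE /H.
  (* Half of the friction dt kappa |V'|^2 pays for the discretisation error L dt^2 |V'|^2. *)
  have : 0 <= (kappa - 2 * L * dt) * (dt * `|V l.+1| ^+ 2).
    by rewrite mulr_ge0 ?subr_ge0// mulr_ge0 ?sqr_ge0// ltW.
  by move: (inner _ _) (inner _ _) (F _) (F _) => *; nra.
have c0 : 0 < dt * kappa / 2 by rewrite divr_gt0// mulr_gt0.
have cvgH : cvgn H.
  apply: nonincreasing_is_cvgn.
    apply/nonincreasing_seqP => l; apply: le_trans (step l).
    by rewrite lerDl mulr_ge0 ?sqr_ge0// ltW.
  exists m => _ [l _ <-]; apply: (le_trans (hm (X l))).
  by rewrite lerDl mulr_ge0 ?sqr_ge0// invr_ge0.
have dH : (fun l => (dt * kappa / 2)^-1 * (H l - H l.+1)) @ \oo --> (0 : R).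
  rewrite -(mulr0 (dt * kappa / 2)^-1) -(subrr (limn H)); apply: cvgMl_tmp.
  by apply: cvgB; [exact: cvgH | rewrite (cvg_shiftS H)].
have V2 : (fun l => `|V l.+1| ^+ 2) @ \oo --> (0 : R).
  apply: (squeeze_cvgr _ (cvg_cst 0) dH); apply: nearW => l.
  by rewrite sqr_ge0 ler_pdivlMl//; have := step l; lra.
have V1 : V l.+1 @[l --> \oo] --> (0 : E).
  apply/cvgr0Pnorm_lt => e e0; near=> l.
  rewrite -(@ltr_pXn2r _ 2)// ?nnegrE// ?(ltW e0)//.
  apply: le_lt_trans (ler_norm _) _; near: l.
  by apply: (cvgr0_norm_lt _ V2); rewrite exprn_gt0.
have V0 : V @ \oo --> (0 : E) by rewrite -(cvg_shiftS V).
split=> //.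
(* From |Z| <= |V'| + |A Z| <= |V'| + |Z| / 2. Hence dt G = V - dt Psi V - Z is controlled by two
   consecutive velocities. *)
have Zle l : `|Z l| <= 2 * `|V l.+1|.
  have := ler_normD (V l.+1) (A (Z l)); rewrite VE subrK.
  by have := bA (Z l); lra.
have Gle l : `|G (X l)| <= dt^-1 * (`|V l| * (1 + dt * P) + 2 * `|V l.+1|).
  rewrite ler_pdivlMl// -(gtr0_norm dt0) -normrZ.
  have -> : dt *: G (X l) = V l - dt *: Psi (X l) (V l) - Z l.
    by rewrite ZE opprB addrC subrK.
  apply: (le_trans (ler_normB _ _)); rewrite lerD//.
  apply: (le_trans (ler_normB _ _)); rewrite mulrDr mulr1 lerD2l.
  by rewrite normrZ gtr0_norm// mulrCA ler_wpM2l ?(ltW dt0)// mulrC.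
apply/norm_cvg0P; apply: (@squeeze_cvgr _ _ _ _ (cst 0)
  (fun l => dt^-1 * (`|V l| * (1 + dt * P) + 2 * `|V l.+1|))); last 2 first.
- exact: cvg_cst.
- rewrite [X in _ --> X](_ : 0 =
      dt^-1 * (`|0 : E| * (1 + dt * P) + 2 * `|0 : E|)).
    apply: cvgMl_tmp; apply: cvgD.
      by apply: cvgMr_tmp; exact: cvg_norm.
    by apply: cvgMl_tmp; exact: cvg_norm.
  by rewrite normr0 mul0r mulr0 addr0 mulr0.
- by apply: nearW => l; rewrite normr_ge0 Gle.
Unshelve. all: by end_near. Qed.

End energy.

(** * The operator T, its roots, and the reduced form of the velocity update *)

Section damping.
Context {R : realType} {E U : hilbertType R} (B : {linear U -> E}).
Context (dt rho c : R).
Hypothesis cB : continuous B.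
Local Notation A := (BBadj B).
Local Notation a := (opnorm A).
Local Notation c2 := (c2 dt rho c).
Local Notation T := (opT B dt rho c).
Local Notation S := (sqrt_op T).
Local Notation Si := (opT_invsqrt B dt rho c).
Hypothesis c2_gt0 : 0 < c2.
Hypothesis c2_small : c2 * a <= 2^-1.

Let lA : linear A := BBadj_linear cB.

Lemma scaled_BBadj_linear : linear (fun x => c2 *: A x).
Proof. by move=> k x y; rewrite lA scalerDr !scalerA mulrC. Qed.

Lemma scaled_BBadj_self_adjoint : self_adjoint (fun x => c2 *: A x).
Proof. by move=> x y; rewrite innerZl innerZr BBadj_self_adjoint. Qed.

Lemma scaled_BBadj_inner x : inner (c2 *: A x) x = c2 * `|adjoint B x| ^+ 2.
Proof. by rewrite innerZl BBadj_inner// inner_norm. Qed.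

Lemma scaled_BBadj_psd : positive_semidefinite (fun x => c2 *: A x).
Proof.
by move=> x; rewrite innerC scaled_BBadj_inner mulr_ge0 ?sqr_ge0// ltW.
Qed.

Lemma scaled_BBadj_bound x : `|c2 *: A x| <= 2^-1 * `|x|.
Proof.
rewrite normrZ gtr0_norm//.
apply: (@le_trans _ _ (c2 * (a * `|x|))); last by rewrite mulrA ler_wpM2r.
by rewrite ler_pM2l// le_opnorm//; exact: BBadj_continuous.
Qed.

Lemma sqrt_opT : [/\ linear S, continuous S, self_adjoint S,
  positive_semidefinite S & S \o S = T].
Proof.
exact: (xgetPex (idfun : E -> E) (sqrt_1subr_exists scaled_BBadj_linear
  scaled_BBadj_self_adjoint scaled_BBadj_bound)).
Qed.

Lemma sqrt_opT_sq x : S (S x) = T x.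
Proof. by have [_ _ _ _ /(congr1 (@^~ x))] := sqrt_opT. Qed.

Lemma opT_linear : linear T.
Proof.
move=> k x y; rewrite /opT lA [c2 *: (_ + _)]scalerDr opprD addrACA scalerBr.
by rewrite !scalerA (mulrC c2).
Qed.

(** |S x|^2 = <x, T x>, and T >= 1/2 because c2 A has norm at most 1/2. *)
Lemma norm_sqrt_opT_ge x : 2^-1 * `|x| ^+ 2 <= `|S x| ^+ 2.
Proof.
have [_ _ sS _ _] := sqrt_opT.
rewrite -[`|S x| ^+ 2]inner_norm sS sqrt_opT_sq /opT innerDr innerNr.
rewrite inner_norm (innerC x) scaled_BBadj_inner.
have := inner_le (c2 *: A x) x; rewrite scaled_BBadj_inner.
have := ler_wpM2r (normr_ge0 x) (scaled_BBadj_bound x).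
by rewrite expr2; lra.
Qed.

Lemma norm_sqrt_opT_le x : `|S x| ^+ 2 <= `|x| ^+ 2.
Proof.
have [_ _ sS _ _] := sqrt_opT.
rewrite -[`|S x| ^+ 2]inner_norm sS sqrt_opT_sq /opT innerDr innerNr.
rewrite inner_norm (innerC x) scaled_BBadj_inner gerBl mulr_ge0 ?sqr_ge0//.
exact: ltW.
Qed.

Lemma sqrt_opT_inj : injective S.
Proof.
have [lS _ _ _ _] := sqrt_opT.
move=> x y xy; apply/subr0_eq/eqP; rewrite -normr_eq0 -sqrf_eq0.
have := norm_sqrt_opT_ge (x - y).
rewrite (linear_sub lS) xy subrr normr0 expr0n /= => h.
by apply/eqP/le_anti; rewrite sqr_ge0 andbT; lra.
Qed.

(** T = S^2 is onto, hence so is S. *)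
Lemma opT_invsqrtK x : S (Si x) = x.
Proof.
apply: (xgetPex 0 (_ : exists z, S z = x)).
have [z hz] := sub1_surj scaled_BBadj_linear scaled_BBadj_bound x.
by exists (S z); rewrite sqrt_opT_sq.
Qed.

Lemma opT_invsqrt_linear : linear Si.
Proof.
have [lS _ _ _ _] := sqrt_opT.
by move=> k x y; apply: sqrt_opT_inj; rewrite opT_invsqrtK lS !opT_invsqrtK.
Qed.

Lemma opT_invsqrt_self_adjoint : self_adjoint Si.
Proof.
have [_ _ sS _ _] := sqrt_opT.
by move=> x y; rewrite -{2}(opT_invsqrtK x) sS opT_invsqrtK.
Qed.

Lemma norm_opT_invsqrt_le x : `|Si x| ^+ 2 <= 2 * `|x| ^+ 2.
Proof. by have := norm_sqrt_opT_ge (Si x); rewrite opT_invsqrtK; lra. Qed.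

Lemma norm_opT_invsqrt_ge x : `|x| ^+ 2 <= `|Si x| ^+ 2.
Proof. by have := norm_sqrt_opT_le (Si x); rewrite opT_invsqrtK. Qed.

Lemma opT_invE x : opT_inv B dt rho c x = Si (Si x).
Proof.
have h : T (opT_inv B dt rho c x) = x.
  apply: (xgetPex 0 (_ : exists z, T z = x)).
  exact: (sub1_surj scaled_BBadj_linear scaled_BBadj_bound x).
by apply: sqrt_opT_inj; apply: sqrt_opT_inj; rewrite !opT_invsqrtK sqrt_opT_sq.
Qed.

(* Uniqueness of the square root is not needed: any S with S^2 = T commutes
   with T, hence with A. *)
Lemma sqrt_opT_comm x : S (A x) = A (S x).
Proof.
have [lS _ _ _ _] := sqrt_opT.
have : S (T x) = T (S x) by rewrite -!sqrt_opT_sq.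
rewrite /opT (linear_sub lS) (linear_scale _ _ lS) => /addrI/oppr_inj.
by apply: scalerI; rewrite gt_eqF.
Qed.

Lemma opT_invsqrt_comm x : Si (A x) = A (Si x).
Proof. by apply: sqrt_opT_inj; rewrite sqrt_opT_comm !opT_invsqrtK. Qed.

Lemma opT_damping x : T (Si (A (Si x))) = A x.
Proof. by rewrite -opT_invsqrt_comm -sqrt_opT_sq !opT_invsqrtK. Qed.

(** By commutation T cancels the two inverse roots around A, and dt * c1 = c2, so the damping turns
    V into T V. The whole update is then T applied to V - dt P - dt G. *)
Lemma damped_step (P G V : E) :
  V - dt *: T (P + c1 dt rho c *: Si (A (Si V))) - dt *: T G =
  (V - dt *: P - dt *: G) - c2 *: A (V - dt *: P - dt *: G).
Proof.
have lT := opT_linear.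
rewrite -[RHS]/(T _) !(linear_sub lT) !(linear_scale _ _ lT) (linear_add lT).
rewrite (linear_scale _ _ lT) opT_damping scalerDr scalerA opprD.
have -> : dt * c1 dt rho c = c2 by rewrite /c1 /Defs.c2; ring.
by rewrite addrA addrAC.
Qed.

Lemma norm_adjoint_opT_invsqrt_le x :
  `|adjoint B (Si x)| ^+ 2 <= 2 * a * `|x| ^+ 2.
Proof.
rewrite -inner_norm -BBadj_inner//; apply: (le_trans (inner_le _ _)).
apply: (@le_trans _ _ (a * `|Si x| ^+ 2)).
  by rewrite expr2 mulrA ler_wpM2r// le_opnorm//; exact: BBadj_continuous.
rewrite (mulrC 2) -mulrA ler_wpM2l ?norm_opT_invsqrt_le//.
by apply: opnorm_ge0 => //; exact: BBadj_continuous.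
Qed.

(** Exact second-order expansion; commuting the inverse root with A puts the linear term into the
    form T^-1 A (x - Xhat). *)
Lemma quad_potentialD (Xhat x d : E) :
  quad_potential B dt rho c Xhat (x + d) = quad_potential B dt rho c Xhat x
    + inner (c3 dt rho c *: opT_inv B dt rho c (A (x - Xhat))) d
    + c3 dt rho c / 2 * `|adjoint B (Si d)| ^+ 2.
Proof.
rewrite /quad_potential addrAC (linear_add opT_invsqrt_linear).
rewrite (linear_add (adjoint_linear cB)) normD_sq -BBadj_inner//.
rewrite innerZl opT_invE opT_invsqrt_self_adjoint opT_invsqrt_comm.
by field.
Qed.

End damping.

(** * The parameter window and convergence of the scheme *)

Section scheme.
Context {R : realType} {E U : hilbertType R} (B : {linear U -> E}).
Hypothesis cB : continuous B.
Local Notation A := (BBadj B).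
Local Notation a := (opnorm A).

Lemma opnorm_BBadj_ge0 : 0 <= a.
Proof. exact: opnorm_ge0 (BBadj_linear cB) (BBadj_continuous cB). Qed.

Lemma rho_windowP (dt rho c gamma alpha : R) :
  0 < dt -> 0 < rho -> 0 <= c -> rho_window B dt rho c gamma alpha ->
  [/\ 0 < a, 0 < c2 dt rho c & gamma * alpha <= c2 dt rho c * a <= alpha].
Proof.
move=> dt0 rho0 c0 /andP[lo hi].
have q0 : 0 < dt ^+ 3 * (1 + c * dt ^+ 2).
  by rewrite mulr_gt0 ?exprn_gt0// ltr_pwDl// mulr_ge0// sqr_ge0.
have a0 : 0 < a.
  (* Division by zero returns 0, so a = 0 would give the window the upper end 0, against rho > 0. *)
  rewrite lt_neqAle opnorm_BBadj_ge0 andbT; apply/eqP => a0.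
  by move: hi; rewrite -a0 mulr0 invr0 mulr0 leNgt rho0.
have c2E : c2 dt rho c = rho * (dt ^+ 3 * (1 + c * dt ^+ 2)).
  by rewrite /c2 mulrA.
rewrite c2E; split=> //; first by rewrite mulr_gt0.
have qa0 := mulr_gt0 q0 a0; rewrite -[rho * _ * _]mulrA.
by move: lo hi; rewrite (ler_pdivrMr _ _ qa0) (ler_pdivlMr _ _ qa0) => -> ->.
Qed.

Context (dt rho c : R).
Hypothesis dt_gt0 : 0 < dt.
Hypothesis rho_gt0 : 0 < rho.
Hypothesis c_ge0 : 0 <= c.
Hypothesis c2_gt0 : 0 < c2 dt rho c.
Hypothesis c2_small : c2 dt rho c * a <= 2^-1.

Lemma c3_ge0 : 0 <= c3 dt rho c.
Proof. by rewrite /c3 !mulr_ge0// ?exprn_ge0// ltW. Qed.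

(** c3 (1 + c dt^2) = c c2, and c2 a <= 1/2. This bounds the curvature of the steering potential
    independently of dt, although rho grows like dt^-3. *)
Lemma c3_le : c3 dt rho c * a <= c.
Proof.
have : c3 dt rho c <= c * c2 dt rho c.
  rewrite /c3 /c2 -[c * rho * _]mulrA ler_wpM2l// ler_peMr//.
    by rewrite mulr_ge0 ?exprn_ge0// ltW.
  by rewrite lerDl mulr_ge0// sqr_ge0.
move=> h; apply: (le_trans (ler_wpM2r opnorm_BBadj_ge0 h)).
rewrite -[c * _ * _]mulrA; apply: (le_trans (ler_wpM2l c_ge0 c2_small)).
by have := c_ge0; lra.
Qed.

Variables (Xhat e : E).
Let shifted (x : E) : R :=
  quad_potential B dt rho c Xhat x - inner e (x - Xhat).
Let gshifted (x : E) : E :=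
  c3 dt rho c *: opT_inv B dt rho c (A (x - Xhat)) - e.

Lemma shiftedD x d : shifted (x + d) = shifted x + inner (gshifted x) d
  + c3 dt rho c / 2 * `|adjoint B (opT_invsqrt B dt rho c d)| ^+ 2.
Proof.
rewrite /shifted /gshifted quad_potentialD// (addrAC x) (innerDr (x - Xhat)).
rewrite [inner (_ - e) d]innerDl innerNl; ring.
Qed.

Lemma shifted_rem d :
  0 <= c3 dt rho c / 2 * `|adjoint B (opT_invsqrt B dt rho c d)| ^+ 2
    <= c * `|d| ^+ 2.
Proof.
rewrite mulr_ge0 ?sqr_ge0 ?divr_ge0 ?c3_ge0//=.
apply: (@le_trans _ _ (c3 dt rho c / 2 * (2 * a * `|d| ^+ 2))).
  rewrite ler_wpM2l ?divr_ge0 ?c3_ge0//; exact: norm_adjoint_opT_invsqrt_le.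
rewrite (_ : _ * _ = c3 dt rho c * a * `|d| ^+ 2); last by field.
by rewrite ler_wpM2r ?sqr_ge0 ?c3_le.
Qed.

Lemma grad_shifted x : grad shifted x = gshifted x.
Proof.
apply: (@is_grad _ _ _ _ _ c) => h; rewrite shiftedD.
have /andP[r0 r1] := shifted_rem h.
by rewrite [X in `|X|](_ : _ = c3 dt rho c / 2 *
  `|adjoint B (opT_invsqrt B dt rho c h)| ^+ 2) ?ger0_norm//; ring.
Qed.

(* [e] is 0 in part (i) and [grad pot Xhat] in part (ii). *)
Lemma scheme_convergence (pot : E -> R) (Psi : E -> {linear E -> E})
    (L P kappa m : R) (X0 V0 : E) (X V : nat -> E) :
  (forall x, differentiable pot x) -> 0 <= L ->
  (forall x y, `|grad pot x - grad pot y| <= L * `|x - y|) ->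
  (forall x, m <= pot x + shifted x) ->
  (forall x, self_adjoint (Psi x)) ->
  (forall x, positive_semidefinite (Psi x)) ->
  (forall x y, `|Psi x y| <= P * `|y|) ->
  2 * dt * P <= 1 -> 0 < kappa -> 2 * (L + c) * dt <= kappa ->
  (forall x w, dt * kappa * `|w| ^+ 2 <=
    c2 dt rho c * `|adjoint B w| ^+ 2 + dt / 2 * inner w (Psi x w)) ->
  iterates B dt rho c Psi pot shifted X0 V0 X V ->
  V @ \oo --> (0 : E) /\
  grad pot (X l) + gshifted (X l) @[l --> \oo] --> (0 : E).
Proof.
move=> df L0 lip low sP pP bP dtP k0 Lk coer [_ _ XE VE].
pose Z l := V l - dt *: Psi (X l) (V l)
  - dt *: (grad pot (X l) + gshifted (X l)).
apply: (@energy_convergence _ _ (fun x => pot x + shifted x)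
  (fun x => grad pot x + gshifted x) (fun x => Psi x)
  (fun x => c2 dt rho c *: A x) (L + c) P dt kappa m X V Z) => //.
- exact: scaled_BBadj_linear.
- exact: scaled_BBadj_self_adjoint.
- exact: scaled_BBadj_psd.
- exact: scaled_BBadj_bound.
- by move=> x k y z; rewrite linearP.
- move=> x d; rewrite shiftedD.
  have := descent df L0 lip x d; have /andP[_] := shifted_rem d.
  by rewrite innerDl; lra.
- by move=> x w; rewrite scaled_BBadj_inner// (innerC _ w).
- by move=> l; rewrite VE grad_shifted damped_step.
Qed.

End scheme.

(** * Combining steering friction on E0 with friction on its complement *)

Section coercivity.
Context {R : realType} {E U : hilbertType R} (B : {linear U -> E}).
Hypothesis cB : continuous B.

(** With p the projection of w, B^* controls p, and replacing B^* p by B^* w costs at most b |w -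
    p|. *)
Lemma subspace_coercive (E0 : set E) (k b : R) :
  linear_subspace E0 -> closed E0 -> 0 < k -> 0 < b ->
  (forall w, E0 w -> `|w| <= k * `|adjoint B w|) ->
  (forall u, `|B u| <= b * `|u|) ->
  forall w, `|w| ^+ 2 <= 2 * k ^+ 2 * `|adjoint B w| ^+ 2
    + (2 * k ^+ 2 * b ^+ 2 + 1) * `|w - orth_proj E0 w| ^+ 2.
Proof.
move=> lE0 cE0 k0 b0 coer bB w.
have [Ep orth] := orth_projP lE0 cE0 w; set p := orth_proj E0 w in Ep orth *.
have -> : `|w| ^+ 2 = `|p| ^+ 2 + `|w - p| ^+ 2.
  by rewrite -{1}(subrK p w) normD_sq orth// mulr0 addr0 addrC.
have h1 : `|adjoint B p| <= `|adjoint B w| + b * `|w - p|.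
  rewrite -[in leLHS](subKr w p) (linear_sub (adjoint_linear cB)).
  apply: (le_trans (ler_normB _ _)); rewrite lerD2l.
  exact: (adjoint_bound cB (ltW b0) bB).
have h2 : `|p| ^+ 2 <= k ^+ 2 * (`|adjoint B w| + b * `|w - p|) ^+ 2.
  rewrite -exprMn ler_pXn2r ?nnegrE//.
    by apply: (le_trans (coer _ Ep)); rewrite ler_pM2l.
  by rewrite mulr_ge0 ?(ltW k0)// addr_ge0// mulr_ge0// ltW.
(* Gives (s + t)^2 <= 2 s^2 + 2 t^2, the source of the factors 2. *)
have h3 : 0 <= k ^+ 2 * (`|adjoint B w| - b * `|w - p|) ^+ 2.
  by rewrite mulr_ge0// sqr_ge0.
by nra.
Qed.

End coercivity.

(** * Step size and Lipschitz constant *)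

Lemma step_size_exists {R : realType} (P L kappa : R) : 0 < kappa ->
  exists h, [/\ 0 < h, h <= 1 & forall dt, 0 < dt <= h ->
    2 * dt * P <= 1 /\ 2 * L * dt <= kappa].
Proof.
(* With h = 1 / D, the three summands yield h <= 1, the bound with P and the bound with L. *)
move=> k0; pose D := 1 + 2 * `|P| + 2 * `|L| / kappa.
have D1 : 1 <= D by rewrite /D -addrA lerDl addr_ge0 ?mulr_ge0 ?invr_ge0// ltW.
have D0 : 0 < D by exact: lt_le_trans D1.
exists D^-1; split; rewrite ?invr_gt0 ?invf_le1// => dt /andP[dt0].
rewrite -[D^-1]mul1r ler_pdivlMr// => dtD.
have kL : 0 <= dt * (2 * `|L| / kappa).
  by rewrite mulr_ge0 ?(ltW dt0)// divr_ge0 ?(ltW k0)// mulr_ge0.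
have P0 : 0 <= dt * `|P| by rewrite mulr_ge0// ltW.
move: dtD; rewrite /D mulrDr mulrDr mulr1 => dtD; split.
  have : dt * P <= dt * `|P| by rewrite ler_pM2l// ler_norm.
  by lra.
rewrite -[leRHS]mul1r -ler_pdivrMr//.
apply: (@le_trans _ _ (dt * (2 * `|L| / kappa))); last by lra.
rewrite [leLHS](_ : _ = dt * (2 * L / kappa)); last by ring.
by rewrite ler_pM2l// ler_pM2r ?invr_gt0// ler_pM2l// ler_norm.
Qed.

Lemma lipschitz_bound {R : realType} (V W : normedModType R) (f : V -> W) :
  [lipschitz (f x) | x in [set: V]] ->
  exists2 L : R, 0 <= L & forall x y, `|f x - f y| <= L * `|x - y|.
Proof.
move=> /pinfty_ex_gt0[L L0 hL]; exists L; first exact: ltW.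
by move=> x y; have := hL (x, y); apply.
Qed.

(** * Choice of the constants and convergence in both parts *)

Theorem corollary5p15 (R : realType) (E U : hilbertType R)
  (pot : E -> R) (pot_low C : R)
  (Psi : E -> {linear E -> E}) (B : {linear U -> E}) (Xhat : E)
  (hpotC1 : C1 pot)
  (hpotlow : forall X, pot_low <= pot X)
  (hC : 0 < C)
  (hgrowth : forall X, `|grad pot X| ^+ 2 <= C * (1 + pot X - pot_low))
  (hPsicont : forall X, continuous (Psi X))
  (hPsibnd : has_ubound [set opnorm (Psi X) | X in [set: E]])
  (hPsisa : forall X, self_adjoint (Psi X))
  (hPsipsd : forall X, positive_semidefinite (Psi X))
  (hBcont : continuous B)
  (hBclosed : closed (range B))
  (hlip : [lipschitz (grad pot X) | X in [set: E]]) :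
  ((exists psi : R, exists E0 : set E,
      [/\ 0 < psi, linear_subspace E0, closed E0, E0 `<=` range B &
        forall W X, psi * `|W - orth_proj E0 W| ^+ 2 <= inner W (Psi X W)]) ->
   exists alpha : R, 0 < alpha < 1 /\
   forall gamma cmax : R, 0 < gamma <= 1 -> 0 <= cmax ->
   exists h : R, 0 < h /\
   forall dt rho c : R, 0 < dt <= h -> 0 < rho ->
     rho_window B dt rho c gamma alpha -> 0 <= c <= cmax ->
   forall (X0 V0 : E) (X V : nat -> E),
     iterates B dt rho c Psi pot (quad_potential B dt rho c Xhat) X0 V0 X V ->
     V l @[l --> \oo] --> (0 : E) /\
     grad pot (X l)
       + (c * rho * dt ^+ 3) *: opT_inv B dt rho c (BBadj B (X l - Xhat))
       @[l --> \oo] --> (0 : E))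
  /\
  (range B = [set: E] ->
   exists alpha K : R, 0 < alpha < 1 /\ 0 < K /\
   forall gamma cmax cmin : R, 0 < gamma <= 1 ->
     cmin <= cmax ->
     K * opnorm (BBadj B) / (gamma * alpha) < cmin ->
     0 < K * opnorm (BBadj B) / (gamma * alpha) ->
   exists h : R, 0 < h /\
   forall dt rho c : R, 0 < dt <= h -> 0 < rho ->
     rho_window B dt rho c gamma alpha -> cmin <= c <= cmax ->
   forall (X0 V0 : E) (X V : nat -> E),
     iterates B dt rho c Psi pot (tilted_potential B dt rho c pot Xhat)
       X0 V0 X V ->
     V l @[l --> \oo] --> (0 : E) /\ X l @[l --> \oo] --> Xhat).
Proof.
have [dpot _] := hpotC1.
have [L L0 lip] := lipschitz_bound hlip.
have [P hP] := hPsibnd.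
have bP x y : `|Psi x y| <= P * `|y|.
  apply: (@le_trans _ _ (opnorm (Psi x) * `|y|)).
    by apply: le_opnorm => // a u v; rewrite linearP.
  by rewrite ler_wpM2r//; apply: hP; exists x.
have [k k0 coer] := adjoint_coercive hBcont hBclosed.
have [b b0 bB] := linear_lipschitz hBcont.
have a0 := opnorm_BBadj_ge0 hBcont.
have half01 : (0 < 2^-1 :> R) && (2^-1 < 1 :> R) by apply/andP; split; lra.
split.
  move=> [psi [E0 [psi0 lE0 cE0 sE0 hpsi]]]; exists 2^-1; split => //.
  move=> gamma cmax /andP[g0 g1] cmax0.
  have k2 : 0 < 2 * k ^+ 2 by rewrite mulr_gt0// exprn_gt0.
  have M0 : 0 < 2 * k ^+ 2 * b ^+ 2 + 1.
    by rewrite ltr_pwDr// mulr_ge0 ?sqr_ge0// ltW.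
  (* The first entry makes kappa * 2 k^2 <= c2, as gamma / 2 <= c2 |A|; the second does the same
     against psi / 2. The added 1 avoids a zero denominator. *)
  pose kappa := Num.min (gamma / 2 / (opnorm (BBadj B) + 1) / (2 * k ^+ 2))
    (psi / 2 / (2 * k ^+ 2 * b ^+ 2 + 1)).
  have kappa0 : 0 < kappa.
    by rewrite lt_min !divr_gt0// ltr_pwDr.
  have [h [h0 h1 hh]] := step_size_exists P (L + cmax) kappa0.
  exists h; split=> // dt rho c dth rho0 window /andP[c0 cc] X0 V0 X V.
  have /andP[dt0 dtle] := dth.
  have [dtP dtL] := hh dt dth.
  have [a_gt0 c2_gt0 /andP[c2lo c2hi]] := rho_windowP hBcont dt0 rho0 c0 window.
  have -> : quad_potential B dt rho c Xhat =
      (fun x => quad_potential B dt rho c Xhat x - inner 0 (x - Xhat)).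
    by apply/funext => x; rewrite inner0l subr0.
  have coercive x w : dt * kappa * `|w| ^+ 2 <=
      c2 dt rho c * `|adjoint B w| ^+ 2 + dt / 2 * inner w (Psi x w).
    have ht := subspace_coercive hBcont lE0 cE0 k0 b0
      (fun w Ew => coer w (sE0 w Ew)) bB w.
    have k1 : kappa * (2 * k ^+ 2) <= c2 dt rho c.
      apply: (@le_trans _ _ (gamma / 2 / (opnorm (BBadj B) + 1))).
        by rewrite -ler_pdivlMr// ge_min lexx.
      rewrite ler_pdivrMr ?ltr_pwDr// mulrDr; apply: (le_trans c2lo).
      by rewrite lerDl mulr1 ltW.
    have k3 : kappa * (2 * k ^+ 2 * b ^+ 2 + 1) <= psi / 2.
      by rewrite -ler_pdivlMr// ge_min lexx orbT.
    have dt1 : dt <= 1 by exact: le_trans h1.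
    have := hpsi w x.
    move: (sqr_ge0 `|adjoint B w|) (sqr_ge0 `|w - orth_proj E0 w|) ht.
    move: (`|adjoint B w| ^+ 2) (`|w - orth_proj E0 w| ^+ 2) (`|w| ^+ 2).
    move: (inner w _).
    move=> i s t n s0 t0 ht hi.
    have e1 := ler_wpM2l (ltW (mulr_gt0 dt0 kappa0)) ht.
    have e2 := ler_wpM2r s0 k1.
    have e3 := ler_wpM2r t0 k3.
    (* The steering friction carries no factor dt, so dt <= 1 suffices for this component. *)
    have e4 : dt * (c2 dt rho c * s) <= c2 dt rho c * s.
      by rewrite ler_piMl// mulr_ge0// ltW.
    have e5 := ler_wpM2l (ltW dt0) e2.
    have e6 := ler_wpM2l (ltW dt0) (le_trans e3 (_ : _ <= i / 2)).
    have e7 : psi / 2 * t <= i / 2 by lra.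
    have := e6 e7; nra.
  have low x : pot_low <=
      pot x + (quad_potential B dt rho c Xhat x - inner 0 (x - Xhat)).
    rewrite inner0l subr0; apply: (le_trans (hpotlow x)).
    rewrite lerDl /quad_potential mulr_ge0 ?sqr_ge0 ?divr_ge0//.
    exact: c3_ge0.
  have dtL' : 2 * (L + c) * dt <= kappa.
    by apply: le_trans dtL; rewrite ler_pM2r// ler_pM2l// lerD2l.
  move=> it.
  have [Vc Gc] := scheme_convergence hBcont dt0 rho0 c0 c2_gt0 c2hi dpot L0 lip
    low hPsisa hPsipsd bP dtP kappa0 dtL' coercive it.
  split=> //; move: Gc; rewrite /c3.
  by under eq_fun do rewrite subr0.
move=> surjB.
have {}coer w : `|w| <= k * `|adjoint B w| by apply: coer; rewrite surjB.
have k2 : 0 < k ^+ 2 by rewrite exprn_gt0.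
have coer2 w : `|w| ^+ 2 <= k ^+ 2 * `|adjoint B w| ^+ 2.
  by rewrite -exprMn ler_pXn2r ?nnegrE// mulr_ge0// ltW.
(* K is chosen so that the steering curvature c3 / k^2 is at least L + 1: L beats the Lipschitz
   constant, and 1 is the margin of strong monotonicity. *)
exists 2^-1, (2 * k ^+ 2 * (L + 1)); split=> //; split.
  by rewrite !mulr_gt0// ltr_pwDr.
move=> gamma cmax cmin /andP[g0 g1] cc hK K0.
pose kappa := gamma / 2 / (opnorm (BBadj B) + 1) / k ^+ 2.
have kappa0 : 0 < kappa by rewrite !divr_gt0// ltr_pwDr.
have cmin0 : 0 < cmin by exact: lt_trans hK.
have cmax0 : 0 < cmax by exact: lt_le_trans cc.
(* With cmax in the place of P, this gives 2 dt cmax <= 1, which later bounds 1 + c dt^2 by 2. *)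
have [h [h0 h1 hh]] := step_size_exists cmax (L + cmax) kappa0.
have [h' [h0' h1' hh']] := step_size_exists P (L + cmax) kappa0.
exists (Num.min h h'); split; first by rewrite lt_min h0.
move=> dt rho c /andP[dt0]; rewrite le_min => /andP[dth dth'] rho0 window.
move=> /andP[cminc ccmax] X0 V0 X V.
have c_gt0 : 0 < c by exact: lt_le_trans cminc.
have c0 := ltW c_gt0.
have [dtc dtL] := hh dt (introT andP (conj dt0 dth)).
have [dtP _] := hh' dt (introT andP (conj dt0 dth')).
have [a_gt0 c2_gt0 /andP[c2lo c2hi]] := rho_windowP hBcont dt0 rho0 c0 window.
have dt1 : dt <= 1 by exact: le_trans h1.
have dtL' : 2 * (L + c) * dt <= kappa.
  by apply: le_trans dtL; rewrite ler_pM2r// ler_pM2l// lerD2l.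
have coercive x w : dt * kappa * `|w| ^+ 2 <=
    c2 dt rho c * `|adjoint B w| ^+ 2 + dt / 2 * inner w (Psi x w).
  have k1 : kappa * k ^+ 2 <= c2 dt rho c.
    rewrite /kappa divfK ?gt_eqF// ler_pdivrMr ?ltr_pwDr// mulrDr.
    by apply: (le_trans c2lo); rewrite lerDl mulr1 ltW.
  apply: (@le_trans _ _ (c2 dt rho c * `|adjoint B w| ^+ 2)).
    apply: (@le_trans _ _ (kappa * `|w| ^+ 2)).
      by rewrite ler_wpM2r ?sqr_ge0// ler_piMl// ltW.
    apply: (le_trans (ler_wpM2l (ltW kappa0) (coer2 w))).
    by rewrite mulrA ler_wpM2r ?sqr_ge0.
  by rewrite lerDl mulr_ge0 ?divr_ge0 ?(ltW dt0)//; exact: hPsipsd.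
(* Chain: K |A| <= c gamma / 2 <= c c2 |A| <= 2 c3 |A|, then division by 2 k^2 |A|. *)
have c3lo : L + 1 <= c3 dt rho c / k ^+ 2.
  rewrite ler_pdivlMr// -(ler_pM2r a_gt0).
  have ga : 0 < gamma * 2^-1 by rewrite divr_gt0.
  have hc : 2 * k ^+ 2 * (L + 1) * opnorm (BBadj B) <= c * (gamma * 2^-1).
    by rewrite -ler_pdivrMr// (le_trans (ltW hK)).
  have hc2 : c * c2 dt rho c <= c3 dt rho c * 2.
    rewrite (_ : c * _ = c3 dt rho c * (1 + c * dt ^+ 2)); last first.
      by rewrite /c2 /c3; ring.
    rewrite ler_wpM2l ?c3_ge0// -lerBrDl (_ : 2 - 1 = 1 :> R); last by ring.
    have h3 : c * dt ^+ 2 <= cmax * dt.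
      rewrite expr2 mulrA ler_wpM2r ?(ltW dt0)//.
      by rewrite (le_trans _ ccmax)// ler_piMr.
    by apply: (le_trans h3); lra.
  have h4 := ler_wpM2l c0 c2lo.
  have h5 := ler_wpM2r (ltW a_gt0) hc2.
  by move: hc h4 h5; rewrite !mulrA; lra.
have c3_gt0 : 0 < c3 dt rho c by rewrite /c3 !mulr_gt0// exprn_gt0.
have quadlo x : `|x| ^+ 2 / k ^+ 2 <=
    `|adjoint B (opT_invsqrt B dt rho c x)| ^+ 2.
  rewrite ler_pdivrMr// mulrC; apply: le_trans (coer2 _).
  exact: norm_opT_invsqrt_ge.
set e := grad pot Xhat.
pose mu := c3 dt rho c / k ^+ 2.
have mu0 : 0 < mu by rewrite divr_gt0.
(* The quadratic part is at least (mu / 2) |x - Xhat|^2; completing the square against the linear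
   tilt loses at most |e|^2 / (2 mu). *)
have low x : pot_low - `|e| ^+ 2 / (2 * mu) <=
    pot x + (quad_potential B dt rho c Xhat x - inner e (x - Xhat)).
  rewrite lerD//.
  have h3 : mu / 2 * `|x - Xhat| ^+ 2 <= quad_potential B dt rho c Xhat x.
    rewrite /mu /quad_potential [leLHS](_ : _ = c3 dt rho c / 2 *
      (`|x - Xhat| ^+ 2 / k ^+ 2)); last by field; rewrite gt_eqF.
    by rewrite ler_wpM2l// divr_ge0// ltW.
  have h4 := inner_le e (x - Xhat).
  have h5 : 0 <= (mu * `|x - Xhat| - `|e|) ^+ 2 / (2 * mu).
    by rewrite divr_ge0 ?sqr_ge0// mulr_ge0// ltW.
  have h6 : (mu * `|x - Xhat| - `|e|) ^+ 2 / (2 * mu) =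
    mu / 2 * `|x - Xhat| ^+ 2 - `|e| * `|x - Xhat| + `|e| ^+ 2 / (2 * mu).
    by field; rewrite gt_eqF.
  by lra.
move=> it.
have [Vc Gc] := scheme_convergence hBcont dt0 rho0 c0 c2_gt0 c2hi dpot L0 lip
  low hPsisa hPsipsd bP dtP kappa0 dtL' coercive it.
split=> //.
(* Paired with x - Xhat, the steering term contributes at least (L + 1) |x - Xhat|^2 and the
   difference of the gradients of pot costs at most L |x - Xhat|^2. *)
have mono x : `|x - Xhat| <= `|grad pot x +
    (c3 dt rho c *: opT_inv B dt rho c (BBadj B (x - Xhat)) - e)|.
  set g := (X in _ <= `|X|).
  have [->|x0] := eqVneq `|x - Xhat| 0; first exact: normr_ge0.
  have nx : 0 < `|x - Xhat| by rewrite lt_neqAle eq_sym x0 normr_ge0.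
  rewrite -(ler_pM2r nx) -expr2; apply: le_trans (inner_le _ _).
  have gE : inner g (x - Xhat) = inner (grad pot x - e) (x - Xhat)
      + c3 dt rho c * `|adjoint B (opT_invsqrt B dt rho c (x - Xhat))| ^+ 2.
    rewrite /g !innerDl innerNl innerZl opT_invE// opT_invsqrt_self_adjoint//.
    by rewrite opT_invsqrt_comm// BBadj_inner// inner_norm; ring.
  have h3 : (L + 1) * `|x - Xhat| ^+ 2 <=
      c3 dt rho c * `|adjoint B (opT_invsqrt B dt rho c (x - Xhat))| ^+ 2.
    apply: (le_trans (ler_wpM2r (sqr_ge0 _) c3lo)).
    by rewrite mulrAC -mulrA ler_pM2l.
  have h4 := inner_le (- (grad pot x - e)) (x - Xhat).
  have h5 := ler_wpM2r (normr_ge0 (x - Xhat)) (lip x Xhat).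
  move: h4; rewrite innerNl normrN gE; rewrite -mulrA -expr2 in h5.
  by lra.
apply/cvgrPdist_lt => r r0; near=> l.
rewrite distrC; apply: (le_lt_trans (mono (X l))); near: l.
exact: (cvgr0_norm_lt _ Gc).
Unshelve. all: by end_near. Qed.
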